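(* Let $n\ge1$ and $0<\alpha<n$. There exist constants $c_1,c_2>0$, depending only on $\alpha$ and $n$, such that for every $\epsilon>0$ there exists a function $f\ge0$ on $\mathbf{R}^n$ with $$\bigl|\{x : \mathcal{I}_\alpha(f)(x)>2,\ \mathcal{M}_\alpha(f)(x)\le\epsilon\}\bigr|\ge c_1e^{-c_2/\epsilon}\,\bigl|\{x : \mathcal{I}_\alpha(f)(x)>1\}\bigr| .$$
   Context: $|E|$ denotes Lebesgue measure. For $k\in\mathbf{Z}$, $\mathcal{Q}_k$ is the collection of dyadic cubes of side length $2^k$, i.e. the translates of $[0,2^k)^n$ by $2^k m$, $m\in\mathbf{Z}^n$, and $\mathcal{Q}=\bigcup_{k\in\mathbf{Z}}\mathcal{Q}_k$ is the dyadic lattice; $\ell(Q)$ is the side length of $Q$. For a nonnegative measurable function $f$ (identified with the measure $f\,dx$), the dyadic Riesz potential and the dyadic fractional maximal operator are $$\mathcal{I}_\alpha(f)(x)=\sum_{x\in Q\in\mathcal{Q}}\frac{1}{\ell(Q)^{n-\alpha}}\int_Q f\,dy,\qquad \mathcal{M}_\alpha(f)(x)=\sup_{x\in Q\in\mathcal{Q}}\frac{1}{\ell(Q)^{n-\alpha}}\int_Q f\,dy.$$ *)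

(* Defs.v *)
From HB Require Import structures.
From mathcomp Require Import all_boot all_order all_algebra.
From mathcomp Require Import all_classical all_reals all_analysis.

Set Implicit Arguments.
Unset Strict Implicit.
Unset Printing Implicit Defensive.

Import Order.TTheory GRing.Theory Num.Theory.
Import numFieldNormedType.Exports.

Local Open Scope classical_set_scope.
Local Open Scope ring_scope.
Local Open Scope ereal_scope.

(* R^n is [n.-tuple R] with its product (Borel) sigma-algebra, and [leb n] is
   Lebesgue measure on it, built as an iterated product.  Lemma [leb_box]
   gives the usual value on boxes. *)
Fixpoint leb {R : realType} (n : nat) : set (n.-tuple R) -> \bar R :=
  match n with
  | 0 => dirac [tuple]
  | m.+1 => pushforward (@lebesgue_measure R \x @leb R m)
              (fun z => [tuple of z.1 :: z.2])
  end.
Arguments leb {R} n _.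

Section leb_measure.
Context {R : realType}.

Let tcons n (z : R * n.-tuple R) : n.+1.-tuple R := [tuple of z.1 :: z.2].

Let tuncons n (x : n.+1.-tuple R) : R * n.-tuple R :=
  (thead x, [tuple of behead x]).

Let tconsK n : cancel (@tcons n) (@tuncons n).
Proof.
by case=> a t; rewrite /tcons /tuncons theadE; congr pair; exact: val_inj.
Qed.

Let measurable_tcons n : measurable_fun setT (@tcons n).
Proof. by apply: measurable_cons. Qed.

Let measurable_tuncons n : measurable_fun setT (@tuncons n).
Proof.
apply/measurable_fun_pair; first exact: measurable_tnth.
exact: measurable_behead.
Qed.

Let leb_is_sigma_finite n :
  exists mu : {sigma_finite_measure set (n.-tuple R) -> \bar R},
    @leb R n = mu.
Proof.
elim: n => [|n [mu lebE]]; first by exists (dirac [tuple]).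
pose P : {measure set (measurableTypeR R * n.-tuple R)%type -> \bar R} :=
  (@lebesgue_measure R \x mu)%E.
have Psf : sigma_finite setT P.
  have /sigma_finiteP[F [TF ndF Foo]] := sigma_finiteT (@lebesgue_measure R).
  have /sigma_finiteP[G [TG ndG Goo]] := sigma_finiteT mu.
  exists (fun k => F k `*` G k).
    rewrite -setXTT TF TG predeqE => -[x y]; split.
      move=> [/= [i _ Fix] [k _ Gky]]; exists (maxn i k) => //; split.
      - by move: x Fix; exact/subsetPset/ndF/leq_maxl.
      - by move: y Gky; exact/subsetPset/ndG/leq_maxr.
    by move=> [i _ []/= ? ?]; split; exists i.
  move=> k; have [? ?] := Foo k; have [? ?] := Goo k.
  split; first exact: measurableX.
  by rewrite /P /= product_measure1E// lte_mul_pinfty// ge0_fin_numE.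
pose Q : set (n.+1.-tuple R) -> \bar R := pushforward P (@tcons n).
have Q0 : Q set0 = 0 by rewrite /Q /pushforward preimage_set0 measure0.
have Qge0 A : 0 <= Q A by rewrite /Q /pushforward measure_ge0.
have Qadd : semi_sigma_additive Q.
  move=> F mF tF mUF; rewrite /Q /pushforward preimage_bigcup.
  have mpre B : measurable B -> measurable (@tcons n @^-1` B).
    by move=> mB; rewrite -[X in measurable X]setTI; exact: measurable_tcons.
  apply: measure_semi_sigma_additive.
  - by move=> k; exact: mpre.
  - apply/trivIsetP => /= i j _ _ ij; rewrite -preimage_setI.
    by move/trivIsetP : tF => -> //; rewrite preimage_set0.
  - by rewrite -preimage_bigcup; exact: mpre.
have Qsf : sigma_finite setT Q.
  have [F FT Foo] := Psf.
  exists (fun k => @tuncons n @^-1` F k).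
    by rewrite -preimage_bigcup -FT preimage_setT.
  move=> k; have [mF Fk] := Foo k; split.
    by rewrite -[X in measurable X]setTI; exact: measurable_tuncons.
  rewrite /Q /pushforward (_ : _ @^-1` _ = F k)//.
  by apply/seteqP; split=> z /=; rewrite tconsK.
pose mQ := isMeasure.Build _ _ _ Q Q0 Qge0 Qadd.
pose mQ1 : {measure set (n.+1.-tuple R) -> \bar R} := HB.pack Q mQ.
pose sQ := @Measure_isSigmaFinite.Build _ _ _ mQ1 Qsf.
pose Q' : {sigma_finite_measure set (n.+1.-tuple R) -> \bar R} :=
  HB.pack Q (Measure.on mQ1) sQ.
by exists Q'; rewrite /= lebE.
Qed.

Let leb0 n : @leb R n set0 = 0.
Proof. by have [mu ->] := leb_is_sigma_finite n; exact: measure0. Qed.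

Let leb_ge0 n A : 0 <= @leb R n A.
Proof. by have [mu ->] := leb_is_sigma_finite n; exact: measure_ge0. Qed.

Let leb_semi_sigma_additive n : semi_sigma_additive (@leb R n).
Proof.
by have [mu ->] := leb_is_sigma_finite n; exact: measure_semi_sigma_additive.
Qed.

HB.instance Definition _ n := isMeasure.Build _ _ _ (@leb R n)
  (@leb0 n) (@leb_ge0 n) (@leb_semi_sigma_additive n).

Let leb_sigma_finite n : sigma_finite setT (@leb R n).
Proof. by have [mu ->] := leb_is_sigma_finite n; exact: sigma_finiteT. Qed.

HB.instance Definition _ n := Measure_isSigmaFinite.Build _ _ _ (@leb R n)
  (@leb_sigma_finite n).

Lemma leb_box n (A : 'I_n -> set R) : (forall i, measurable (A i)) ->
  leb n [set x : n.-tuple R | forall i, A i (tnth x i)] =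
  \prod_(i < n) lebesgue_measure (A i).
Proof.
elim: n A => [|n IHn] A mA.
  by rewrite big_ord0 /= diracE mem_set// => -[].
rewrite big_ord_recl -IHn; last by move=> i; exact: mA.
rewrite -product_measure1E//; last 2 first.
- exact: mA.
- rewrite (_ : [set x | _] =
    \bigcap_(i in [set: 'I_n]) ((@tnth n R)^~ i @^-1` A (lift ord0 i))).
    apply: fin_bigcap_measurable => // i _.
    by rewrite -[X in measurable X]setTI; exact: measurable_tnth.
  by apply/seteqP; split=> x /= h i => [_|]; exact: h.
apply: (congr1 (@lebesgue_measure R \x @leb R n)); apply/seteqP.
split=> -[a t] /=.
- move=> h; split=> [|i]; first by have := h ord0; rewrite tnth0.
  by have := h (lift ord0 i); rewrite tnthS.
- by move=> [Aa At] i; case: (unliftP ord0 i) => [j|] ->; rewrite ?tnthS ?tnth0.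
Qed.

End leb_measure.

Section dyadic.
Context {R : realType} {n : nat}.
Implicit Types (f : n.-tuple R -> R) (x : n.-tuple R).

(* (k, m) stands for the cube 2^k m + [0, 2^k)^n; for n >= 1 distinct indices
   give distinct cubes. *)
Definition dyadic_index : Type := int * n.-tuple int.

Definition side (Q : dyadic_index) : R := (2 : R) ^ Q.1.

Definition dyadic_cube (Q : dyadic_index) : set (n.-tuple R) :=
  [set x | forall i : 'I_n,
    (side Q * (tnth Q.2 i)%:~R <= tnth x i < side Q * ((tnth Q.2 i)%:~R + 1))%R].

Definition dyadic_avg (alpha : R) f (Q : dyadic_index) : \bar R :=
  ((side Q `^ (n%:R - alpha))^-1)%:E *
  \int[leb n]_(y in dyadic_cube Q) (f y)%:E.

Definition dyadic_riesz (alpha : R) f x : \bar R :=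
  \esum_(Q in [set Q | dyadic_cube Q x]) dyadic_avg alpha f Q.

Definition dyadic_maximal (alpha : R) f x : \bar R :=
  ereal_sup [set dyadic_avg alpha f Q | Q in [set Q | dyadic_cube Q x]].

End dyadic.

(* Main.v *)
Require Import Defs.
From HB Require Import structures.
From mathcomp Require Import all_boot all_order all_algebra.
From mathcomp Require Import finmap.
From mathcomp Require Import all_classical all_reals all_analysis.
From mathcomp Require Import measurable_realfun.
From mathcomp Require Import ring lra zify.

(** Let Q_k = [0, 2^-k)^n and f = d * \sum_(k <= N) 2^(k alpha) 1_(Q_k), with d
    comparable to min(eps, 1) and N comparable to 1/d.  All the averages of f
    are at most a constant times d, because the contributions to a cube of
    side 2^j decay geometrically in |j + k|; each of Q_0, ..., Q_N has average
    at least d.  Hence the maximal function is at most eps everywhere, while the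
    potential exceeds 2 on Q_N, a set of measure 2^(- n N) = e^(- O(1/eps)).
    Outside Q_0 only the cubes [0, 2^i)^n with i >= 1 see f, and their averages
    form a geometric series of sum at most 1, so that the level set at height 1
    lies in Q_0. *)

Import Order.TTheory GRing.Theory Num.Theory.
Import numFieldNormedType.Exports.

Local Open Scope classical_set_scope.
Local Open Scope ring_scope.

(** * One-sided and two-sided geometric sums *)

Lemma geometric_sum_le {R : realFieldType} (t : R) (N : nat) :
  0 <= t < 1 -> \sum_(k < N) t ^+ k <= (1 - t)^-1.
Proof.
move=> /andP[t0 t1]; have d0 : 0 < 1 - t by rewrite subr_gt0.
rewrite -[leRHS]mul1r ler_pdivlMr// mulrC -opprB mulNr -subrX1 opprB.
by rewrite gerBl exprn_ge0.
Qed.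

(** As [k] varies, [|j + k|] takes each value at most twice, hence the factor 2. *)
Lemma two_sided_geometric_sum_le {R : realFieldType} (t : R) (N : nat) (j : int) :
  0 <= t < 1 -> \sum_(k < N) t ^+ `|(j + k%:Z)%R|%N <= 2 / (1 - t).
Proof.
move=> t01; have /andP[t0 t1] := t01; have d0 : 0 < 1 - t by rewrite subr_gt0.
(* The term [- t ^+ p] strengthens the claim so that it survives induction on [p]. *)
have bnd (p M : nat) :
    \sum_(k < M) t ^+ `|(- p%:Z + k%:Z)%R|%N <= (2 - t ^+ p) / (1 - t).
  elim: p M => [|p IH] M.
    rewrite expr0 (_ : 2 - 1 = 1); last by lra.
    rewrite mul1r; under eq_bigr do rewrite oppr0 add0r.
    exact: geometric_sum_le.
  case: M => [|M].
    rewrite big_ord0 divr_ge0// ?(ltW d0)// subr_ge0.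
    by rewrite (le_trans (exprn_ile1 _ t0 (ltW t1)))// ler1n.
  rewrite big_ord_recl.
  have -> : `|(- (p.+1)%:Z + (@ord0 M)%:Z)%R|%N = p.+1 by rewrite /=; lia.
  rewrite (eq_bigr (fun k : 'I_M => t ^+ `|(- p%:Z + k%:Z)%R|%N)); last first.
    by move=> k _; rewrite lift0; congr (_ ^+ _); lia.
  apply: le_trans (lerD (lexx _) (IH M)) _.
  rewrite -[X in X + _ <= _](mulfK (lt0r_neq0 d0)) -mulrDl ler_pM2r ?invr_gt0//.
  have := exprn_ge0 p t0; rewrite exprS => tp0.
  (* The two sides differ by exactly [t ^+ p * (1 - t) ^+ 2]. *)
  have := mulr_ge0 tp0 (sqr_ge0 (1 - t)); lra.
case: (leP 0 j) => [j0|jn].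
  apply: (@le_trans _ _ (\sum_(k < N) t ^+ k)).
    apply: ler_sum => k _; apply: ler_wiXn2l => //; first exact: ltW.
    by lia.
  apply: le_trans (geometric_sum_le _ _ t01) _.
  by rewrite ler_peMl ?invr_ge0 ?(ltW d0)// ler1n.
have -> : j = - (`|j|%N)%:Z by lia.
apply: le_trans (bnd _ _) _; rewrite ler_pM2r ?invr_gt0//.
by rewrite gerBl exprn_ge0.
Qed.

(** * Measure of dyadic cubes and measurability of the level sets *)

Section cubes.
Context {R : realType} {n : nat}.
Implicit Types (Q : @dyadic_index n) (f : n.-tuple R -> R).

Lemma side_gt0 Q : 0 < side Q :> R.
Proof. by rewrite exprz_gt0. Qed.

Lemma measurable_dyadic_cube Q : measurable (dyadic_cube Q : set (n.-tuple R)).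
Proof.
pose I (i : 'I_n) : interval R :=
  `[side Q * (tnth Q.2 i)%:~R, side Q * ((tnth Q.2 i)%:~R + 1)[.
rewrite (_ : dyadic_cube Q =
    \bigcap_(i in [set: 'I_n]) ((@tnth n R)^~ i @^-1` [set` I i])).
  apply: fin_bigcap_measurable => // i _.
  by rewrite -[X in measurable X]setTI; exact: measurable_tnth.
by apply/seteqP; split=> x /= h i => [_|]; have := h i; rewrite /= in_itv//=; apply.
Qed.

Lemma leb_dyadic_cube Q :
  leb n (dyadic_cube Q : set (n.-tuple R)) = (side Q ^+ n)%:E.
Proof.
pose I (i : 'I_n) : interval R :=
  `[side Q * (tnth Q.2 i)%:~R, side Q * ((tnth Q.2 i)%:~R + 1)[.
rewrite (_ : dyadic_cube Q = [set x | forall i, [set` I i] (tnth x i)]); last first.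
  by apply/seteqP; split=> x /= h i; have := h i; rewrite /= in_itv.
transitivity (\prod_(i < n) lebesgue_measure [set` I i])%E.
  exact: (@leb_box R n (fun i => [set` I i])).
rewrite (eq_bigr (fun=> (side Q)%:E)).
  by rewrite prodEFin prodr_const card_ord.
move=> i _; rewrite lebesgue_measure_itv /= lte_fin ltr_pM2l ?side_gt0//.
by rewrite ltrDl ltr01 -EFinB -mulrBr addrAC subrr add0r mulr1.
Qed.

Lemma dyadic_avg_ge0 alpha f Q : (forall x, 0 <= f x) ->
  (0 <= dyadic_avg alpha f Q)%E.
Proof.
move=> f0; rewrite mule_ge0//; first by rewrite lee_fin invr_ge0 powR_ge0.
by apply: integral_ge0 => y _; rewrite lee_fin.
Qed.

(** The potential exceeds [t] at [x] exactly when some finite subsum over cubes containing [x] does.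
    There are countably many finite families of indices, and each contributes either nothing or a
    finite intersection of cubes. *)
Lemma measurable_dyadic_riesz_gt alpha f (t : R) :
  measurable [set x | (t%:E < dyadic_riesz alpha f x)%E].
Proof.
pose T (X : {fset @dyadic_index n}) :=
  (t%:E < \sum_(Q <- X) dyadic_avg alpha f Q)%E.
rewrite (_ : [set x | _] = \bigcup_(X : {fset @dyadic_index n})
    [set x | T X /\ forall Q, Q \in X -> dyadic_cube Q x]).
  apply: countable_bigcupT_measurable => [|X]; first exact: countableP.
  have [TX|nTX] := pselect (T X); last first.
    by rewrite (_ : [set x | _] = set0)//; apply/seteqP; split=> x //= -[].
  rewrite (_ : [set x | _] = \bigcap_(Q in [set` X]) dyadic_cube Q).
    by apply: fin_bigcap_measurable => // Q _; exact: measurable_dyadic_cube.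
  by apply/seteqP; split=> x //= [].
apply/seteqP; split => x /=.
  move=> /ereal_sup_gt[_ [X [fX XQ] <-]] tX.
  exists (fset_set X) => //; split => [|Q]; first by rewrite /T -fsbig_finite.
  by rewrite in_fset_set// inE => /XQ.
move=> [X _ [TX XQ]]; apply: lt_le_trans TX _; apply: esum_ge.
exists [set` X]; first by split => // Q /=; exact: XQ.
by rewrite fsbig_finite//= set_fsetK.
Qed.

(** The complement is the countable union of the cubes whose average exceeds [t]. *)
Lemma measurable_dyadic_maximal_le alpha f (t : R) :
  measurable [set x | (dyadic_maximal alpha f x <= t%:E)%E].
Proof.
pose B Q : set (n.-tuple R) :=
  [set x | (t%:E < dyadic_avg alpha f Q)%E /\ dyadic_cube Q x].
rewrite (_ : [set x | _] = ~` \bigcup_Q B Q).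
  apply: measurableC; apply: countable_bigcupT_measurable => [|Q]; first exact: countableP.
  have [tQ|ntQ] := pselect (t%:E < dyadic_avg alpha f Q)%E.
    rewrite (_ : B Q = dyadic_cube Q); first exact: measurable_dyadic_cube.
    by apply/seteqP; split=> x // -[].
  by rewrite (_ : B Q = set0)//; apply/seteqP; split=> x // -[].
apply/seteqP; split => x /=.
  move=> Mx [Q _ [tQ Qx]]; move: tQ; apply/negP; rewrite -leNgt.
  by apply: le_trans Mx; apply: ereal_sup_ubound; exists Q.
move=> nB; apply: ge_ereal_sup => _ [Q Qx <-]; rewrite leNgt.
by apply/negP => tQ; apply: nB; exists Q.
Qed.

End cubes.

(** The exponent is that of the side, so the cube Q_k of side 2^-k is [corner_cube (- k)]. *)
Definition corner_cube {n : nat} (k : int) : @dyadic_index n :=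
  (k, [tuple 0 | _ < n]).

(** * Corner cubes and their position among the dyadic cubes *)

Section profile.
Context {R : realType} {n : nat}.
Implicit Types (Q : @dyadic_index n) (x y : n.-tuple R) (d : R).

Lemma corner_cubeE (k : int) x :
  dyadic_cube (corner_cube k) x <-> forall i, 0 <= tnth x i < 2 ^ k.
Proof.
by split=> h i; have := h i; rewrite /side/= tnth_mktuple mulr0 add0r mulr1.
Qed.

Lemma corner_cube_sub (j k : int) : j <= k ->
  (dyadic_cube (corner_cube j) : set (n.-tuple R)) `<=` dyadic_cube (corner_cube k).
Proof.
move=> jk x /corner_cubeE xj; apply/corner_cubeE => i.
have /andP[-> /lt_le_trans->//=] := xj i.
by rewrite ler_eXz2l ?ltr1n.
Qed.

(** By nesting, a dyadic cube of side at most 1 that meets the unit cube lies inside it; so [Q] is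
    larger, and the only larger cube of a given side that meets the unit cube is the one at the
    origin. *)
Lemma dyadic_cube_overhang Q x y : dyadic_cube Q x -> dyadic_cube Q y ->
  dyadic_cube (corner_cube 0) y -> ~ dyadic_cube (corner_cube 0) x ->
  exists i : nat, Q = corner_cube i.+1.
Proof.
case: Q => j m Qx Qy /corner_cubeE y01 nx01.
have j0 : 0 < j.
  rewrite ltNge; apply/negP => j0; apply: nx01; apply/corner_cubeE => i.
  have /andP[y0 y1] := y01 i; have /andP[Qy0 Qy1] := Qy i.
  have /andP[Qx0 Qx1] := Qx i.
  have [p jE] : exists p : nat, j = - p%:Z by exists `|j|%N; lia.
  have s0 := side_gt0 (j, m) : 0 < side (j, m) :> R.
  have sE : side (j, m) * (2 ^ p)%:R = 1 :> R.
    by rewrite /side jE /= -exprz_inv -exprnP natrX -exprMn mulVf ?expr1n.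
  move: s0 sE Qx0 Qx1 Qy0 Qy1 => /=.
  set s := side _; set c := tnth m i => s0 sE Qx0 Qx1 Qy0 Qy1.
  (* The point [y] forces [0 <= c < 2 ^ p]. By integrality [c + 1 <= 2 ^ p], so the whole side of
     the cube, and with it the coordinate of [x], lies in [0, 1). *)
  have c0 : 0 <= c.
    rewrite -ltzD1 -(ltr0z R) intrD -(pmulr_rgt0 _ s0).
    exact: le_lt_trans Qy1.
  have cp : c < (2 ^ p)%:Z.
    rewrite -(ltr_int R) -(ltr_pM2l s0) -pmulrn sE.
    by apply: le_lt_trans Qy0 _; rewrite expr0z in y1.
  rewrite expr0z; apply/andP; split.
    by apply: le_trans Qx0; rewrite mulr_ge0 ?(ltW s0)// ler0z.
  apply: lt_le_trans Qx1 _; rewrite -[leRHS]sE ler_pM2l//.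
  by move: cp; rewrite -lezD1 -(ler_int R) intrD -pmulrn.
(* Now the side is at least 1, and [y] leaves only the offset 0. *)
exists `|j|.-1%N; rewrite /corner_cube; congr pair; first by lia.
apply: eq_from_tnth => i; rewrite tnth_mktuple.
have /andP[y0 y1] := y01 i; have /andP[Qy0 Qy1] := Qy i.
have s0 := side_gt0 (j, m) : 0 < side (j, m) :> R.
have s1 : 1 <= side (j, m) :> R by rewrite /side -(expr0z 2) ler_eXz2l ?ltr1n// ltW.
move: s0 s1 Qy0 Qy1 => /=.
set s := side _; set c := tnth m i => s0 s1 Qy0 Qy1.
have c0 : 0 <= c.
  rewrite -ltzD1 -(ltr0z R) intrD -(pmulr_rgt0 _ s0).
  exact: le_lt_trans Qy1.
have c1 : c < 1.
  rewrite -(ltr_int R) -(ltr_pM2l s0) mulr1.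
  apply: le_lt_trans Qy0 _; apply: lt_le_trans s1.
  by rewrite expr0z in y1.
by lia.
Qed.

(** * The test function and its averages *)

Variable alpha : R.
Hypotheses (alpha_gt0 : 0 < alpha) (alpha_ltn : alpha < n%:R).

Local Notation v := ((2 : R) `^ alpha).
Local Notation u := ((2 : R) `^ (n%:R - alpha)).

(** Per dyadic step away from Q_k, the average of the k-th term decays by [u^-1] towards larger
    cubes and by [v^-1] towards smaller ones; the maximum serves both. *)
Definition decay_ratio : R := Num.max u^-1 v^-1.
Local Notation t := decay_ratio.

Lemma decay_ratio_itv : 0 < t < 1.
Proof.
have P b : 0 < b -> 0 < ((2 : R) `^ b)^-1 < 1.
  move=> b0; rewrite invr_gt0 powR_gt0//= invf_lt1 ?powR_gt0//.
  have := @gt0_ltr_powR _ _ b0 1 2; rewrite powR1 !nnegrE ltr1n.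
  by apply; rewrite ?ler0n.
have /andP[u0 u1] : 0 < u^-1 < 1 by apply: P; rewrite subr_gt0.
have /andP[v0 v1] := P _ alpha_gt0.
by rewrite /decay_ratio lt_max u0 /= gt_max u1.
Qed.

(** The weights [v ^+ k] give each term average exactly [d] over its own cube. *)
Definition profile d (N : nat) x : R :=
  d * \sum_(k < N.+1) v ^+ k * \1_(dyadic_cube (corner_cube (- k%:Z))) x.

Lemma profile_ge0 d N x : 0 <= d -> 0 <= profile d N x.
Proof.
by move=> d0; rewrite mulr_ge0// sumr_ge0.
Qed.

Lemma measurable_profile d N : measurable_fun setT (profile d N).
Proof.
apply: measurable_funM => //; apply: measurable_sum => k.
apply: measurable_funM => //; apply: measurable_indic.
exact: measurable_dyadic_cube.
Qed.

Lemma profile_out d N x : ~ dyadic_cube (corner_cube 0) x -> profile d N x = 0.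
Proof.
move=> nx; rewrite /profile big1 ?mulr0// => k _.
rewrite indicE memNset ?mulr0// => /corner_cube_sub kx.
by apply: nx; apply: kx; rewrite oppr_le0.
Qed.

Lemma side_powR Q : side Q `^ (n%:R - alpha) = u ^ Q.1.
Proof. by rewrite /side -!powR_intmul ?powR_ge0// -!powRrM mulrC. Qed.

(** Splits the volume so that its first factor cancels the normalisation of the average. *)
Lemma side_expn Q : side Q ^+ n = u ^ Q.1 * v ^ Q.1 :> R.
Proof.
rewrite -expfzMl -powRD; last by apply/implyP; rewrite pnatr_eq0.
by rewrite subrK powR_mulrn// /side exprnP exprzAC.
Qed.

Lemma dyadic_avg_profile d N Q : 0 <= d ->
  dyadic_avg alpha (profile d N) Q = (\sum_(k < N.+1)
    ((u ^ Q.1)^-1 * (d * v ^+ k))%:E *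
      leb n (dyadic_cube (corner_cube (- k%:Z)) `&` dyadic_cube Q))%E.
Proof.
move=> d0; rewrite /dyadic_avg side_powR.
have mC (Q' : @dyadic_index n) : measurable (dyadic_cube Q' : set (n.-tuple R)).
  exact: measurable_dyadic_cube.
have c0 (k : 'I_N.+1) : 0 <= d * v ^+ k by rewrite mulr_ge0// exprn_ge0// powR_ge0.
under eq_integral => x _.
  rewrite /profile mulr_sumr -sumEFin.
  under eq_bigr do rewrite mulrA EFinM.
  over.
have mI (k : 'I_N.+1) : measurable_fun (dyadic_cube Q)
    (fun x : n.-tuple R => (\1_(dyadic_cube (corner_cube (- k%:Z))) x)%:E).
  apply/measurable_EFinP; apply: measurable_funTS; exact: measurable_indic.
rewrite ge0_integral_sum//=; last 2 first.
- by move=> k; apply: measurable_funeM; exact: mI.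
- by move=> k x _; rewrite mule_ge0// lee_fin.
rewrite ge0_sume_distrr; last first.
  by move=> k _; apply: integral_ge0 => x _; rewrite mule_ge0// lee_fin.
apply: eq_bigr => k _.
by rewrite ge0_integralZl_EFin ?integral_indic// muleA.
Qed.

(** Term by term, the intersection of Q_k and [Q] has at most the measure of the smaller cube. *)
Lemma dyadic_avg_profile_le d N Q : 0 <= d ->
  (dyadic_avg alpha (profile d N) Q <=
   (d * \sum_(k < N.+1) t ^+ `|(Q.1 + k%:Z)%R|%N)%:E)%E.
Proof.
move=> d0; rewrite dyadic_avg_profile// mulr_sumr -sumEFin.
apply: lee_sum => k _; set j := Q.1.
have mC (Q' : @dyadic_index n) : measurable (dyadic_cube Q' : set (n.-tuple R)).
  exact: measurable_dyadic_cube.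
have u0 : u != 0 by rewrite gt_eqF ?powR_gt0.
have v0 : v != 0 by rewrite gt_eqF ?powR_gt0.
have ui : 0 <= u^-1 by rewrite invr_ge0 powR_ge0.
have vi : 0 <= v^-1 by rewrite invr_ge0 powR_ge0.
have c0 : (0 <= ((u ^ j)^-1 * (d * v ^+ k))%:E)%E.
  by rewrite lee_fin !mulr_ge0 ?invr_ge0 ?exprz_ge0 ?exprn_ge0 ?powR_ge0.
(* If [Q] is the smaller cube, its volume leaves [d * v ^ (j + k)]; otherwise the volume of Q_k
   leaves [d * u ^ (- (j + k))]. *)
have [jk|kj] := leP (j + k%:Z) 0.
  apply: (@le_trans _ _ (((u ^ j)^-1 * (d * v ^+ k))%:E * leb n (dyadic_cube Q))%E).
    apply: lee_wpmul2l => //; apply: le_measure; rewrite ?inE//.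
    exact: measurableI.
  rewrite leb_dyadic_cube side_expn -EFinM lee_fin -/j.
  rewrite [leLHS](_ : _ = d * v^-1 ^+ `|(j + k%:Z)%R|%N).
    by apply: ler_wpM2l => //; apply: lerXn2r; rewrite ?nnegrE// ?le_max ?ui ?vi ?lexx ?orbT.
  rewrite exprnP exprz_inv (_ : - _ = j + k%:Z); last by lia.
  rewrite expfzDr// -exprnP; field.
  by rewrite expfz_neq0.
apply: (@le_trans _ _ (((u ^ j)^-1 * (d * v ^+ k))%:E *
    leb n (dyadic_cube (corner_cube (- k%:Z)) : set (n.-tuple R)))%E).
  apply: lee_wpmul2l => //; apply: le_measure; rewrite ?inE//.
  exact: measurableI.
rewrite leb_dyadic_cube side_expn -EFinM lee_fin /=.
rewrite [leLHS](_ : _ = d * u^-1 ^+ `|(j + k%:Z)%R|%N).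
  by apply: ler_wpM2l => //; apply: lerXn2r; rewrite ?nnegrE// ?le_max ?ui ?vi ?lexx ?orbT.
rewrite exprnP exprz_inv (_ : - (`|(j + k%:Z)%R|%N)%:Z = - j - k%:Z); last by lia.
rewrite expfzDr// -!exprnN -invr_expz; field.
by rewrite !expf_neq0 ?expfz_neq0.
Qed.

(** The j-th term alone gives [d]; the others are nonnegative. *)
Lemma dyadic_avg_profile_ge d N (j : 'I_N.+1) : 0 <= d ->
  (d%:E <= dyadic_avg alpha (profile d N) (corner_cube (- (j : nat)%:Z)))%E.
Proof.
move=> d0; rewrite dyadic_avg_profile// (bigD1 j)//= setIid.
rewrite leb_dyadic_cube side_expn /= -EFinM [X in (X%:E + _)%E](_ : _ = d); last first.
  have u0 : u != 0 by rewrite gt_eqF ?powR_gt0.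
  have v0 : v != 0 by rewrite gt_eqF ?powR_gt0.
  by rewrite -!exprnN; field; rewrite !expf_neq0.
rewrite leeDl// sume_ge0// => k _; rewrite mule_ge0// lee_fin.
by rewrite !mulr_ge0 ?invr_ge0 ?exprz_ge0 ?exprn_ge0 ?powR_ge0.
Qed.

Lemma dyadic_maximal_profile_le d N x : 0 <= d ->
  (dyadic_maximal alpha (profile d N) x <= (d * (2 / (1 - t)))%:E)%E.
Proof.
move=> d0; apply: ge_ereal_sup => _ [Q Qx <-].
apply: le_trans (dyadic_avg_profile_le _ _ _ d0) _.
rewrite lee_fin ler_wpM2l// two_sided_geometric_sum_le//.
by have /andP[/ltW-> ->] := decay_ratio_itv.
Qed.

(** * The potential on the innermost cube and outside the unit cube *)

Lemma dyadic_riesz_profile_ge d N x : 0 <= d ->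
  dyadic_cube (corner_cube (- N%:Z)) x ->
  ((d * N.+1%:R)%:E <= dyadic_riesz alpha (profile d N) x)%E.
Proof.
move=> d0 Nx.
pose e (j : 'I_N.+1) : @dyadic_index n := corner_cube (- (j : nat)%:Z).
have e_inj : injective e.
  by move=> i j [] /eqP; rewrite eqr_opp => /eqP[] /val_inj.
apply: esum_ge; exists [set` [fset e j | j in 'I_N.+1]%fset].
  split; first exact: finite_fset.
  move=> _ /imfsetP[/= j _ ->]; apply: corner_cube_sub Nx.
  by rewrite lerN2 lez_nat -ltnS.
rewrite fsbig_finite//= set_fsetK big_imfset/=; last by move=> i j _ _; exact: e_inj.
rewrite big_enum/=.
apply: (@le_trans _ _ (\sum_(j < N.+1) d%:E)%E).
  by rewrite sumEFin sumr_const card_ord mulr_natr.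
by apply: lee_sum => j _; exact: dyadic_avg_profile_ge.
Qed.

(** One factor [(1 - t)^-1] comes from summing the terms of the profile over a single cube, the
    other from summing over the cubes. *)
Lemma dyadic_riesz_profile_le d N x : 0 <= d ->
  ~ dyadic_cube (corner_cube 0) x ->
  (dyadic_riesz alpha (profile d N) x <= (d / (1 - t) ^+ 2)%:E)%E.
Proof.
move=> d0 nx; have /andP[t0 t1] := decay_ratio_itv.
have tb : 0 <= t < 1 by rewrite t1 ltW.
(* The decay is really [t ^+ i.+1]; one factor of [t] is given away. *)
pose g (i : nat) : \bar R := (d / (1 - t) * t ^+ i)%:E.
pose e (i : nat) : @dyadic_index n := corner_cube i.+1.
have e_inj : injective e by move=> i j [].
have avg_le (i : nat) : (dyadic_avg alpha (profile d N) (e i) <= g i)%E.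
  apply: le_trans (dyadic_avg_profile_le _ _ _ d0) _.
  rewrite lee_fin -mulrA ler_wpM2l//.
  under eq_bigr => k _.
    rewrite (_ : `|_|%N = (k + i.+1)%N); last by rewrite /=; lia.
    rewrite exprD; over.
  rewrite -mulr_suml ler_pM ?geometric_sum_le//.
  - by rewrite sumr_ge0// => k _; rewrite exprn_ge0// ltW.
  - by rewrite exprn_ge0// ltW.
  - by apply: ler_wiXn2l => //; exact: ltW.
(* A cube through [x] outside the range of [e] misses the unit cube, so the profile vanishes on
   it. *)
have -> : dyadic_riesz alpha (profile d N) x =
    \esum_(Q in [set Q | dyadic_cube Q x] `&` range e)
       dyadic_avg alpha (profile d N) Q.
  rewrite esum_mkcondr; apply: eq_esum => Q Qx; case: ifPn => //.
  rewrite notin_setE => /= ne; rewrite /dyadic_avg integral0_eq ?mule0// => y Qy.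
  rewrite profile_out// => y0; apply: ne.
  by have [i ->] := dyadic_cube_overhang _ _ _ Qx Qy y0 nx; exists i.
apply: (@le_trans _ _ (\esum_(Q in range e) dyadic_avg alpha (profile d N) Q)).
  rewrite esum_mkcondl; apply: le_esum => Q _; case: ifP => // _.
  by apply: dyadic_avg_ge0 => y; exact: profile_ge0.
rewrite esum_image; last by move=> i j _ _; exact: e_inj.
apply: le_trans (le_esum (fun i _ => avg_le i)) _.
have g0 i : (0 <= g i)%E.
  by rewrite lee_fin mulr_ge0 ?exprn_ge0 ?divr_ge0 ?subr_ge0// ltW.
rewrite -nneseries_esumT//; apply: lime_le; first exact: is_cvg_nneseries.
apply: nearW => M; rewrite sumEFin lee_fin big_mkord -mulr_sumr expr2 invfM mulrA.
by rewrite ler_wpM2l ?geometric_sum_le// divr_ge0 ?subr_ge0// ltW.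
Qed.

End profile.

(** * Choice of the constants and comparison of the level sets *)

Theorem proposition2p2 (R : realType) (n : nat) (alpha : R)
    (hn : (1 <= n)%N) (halpha0 : 0 < alpha) (halphan : alpha < n%:R) :
  exists c1 c2 : R, [/\ 0 < c1, 0 < c2 &
    forall eps : R, 0 < eps ->
    exists f : n.-tuple R -> R,
      [/\ measurable_fun [set: n.-tuple R] f,
          forall x, 0 <= f x,
          (0 < leb n [set x | (1 < dyadic_riesz alpha f x)%E] < +oo)%E &
          ((c1 * expR (- c2 / eps))%:E *
             leb n [set x | (1 < dyadic_riesz alpha f x)%E] <=
           leb n [set x | (2%:E < dyadic_riesz alpha f x)%E /\
                          (dyadic_maximal alpha f x <= eps%:E)%E])%E]].
Proof.
set t := @decay_ratio R n alpha.
have /andP[t0 t1] : 0 < t < 1 by exact: decay_ratio_itv.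
have s0 : 0 < 1 - t by rewrite subr_gt0.
(* With [d = kappa * m], the bound on the maximal function becomes [m * (1 - t)] and that on the
   potential outside the unit cube becomes [m / 2]. *)
pose kappa := (1 - t) ^+ 2 / 2.
have kappa0 : 0 < kappa by rewrite divr_gt0 ?exprn_gt0.
have ln2 : 0 < ln 2 :> R by rewrite ln_gt0 ?ltr1n.
(* Chosen so that [N * n * ln 2 <= c2 * (1 + eps^-1)]; the part without [eps] becomes the constant
   [expR (- c2)]. *)
pose c2 : R := 2 * n%:R * ln 2 / kappa.
have c20 : 0 < c2 by rewrite divr_gt0// !mulr_gt0// ltr0n.
exists (expR (- c2)), c2; split => // [|eps eps0]; first exact: expR_gt0.
(* The cap at 1 keeps [m / 2 <= 1] when [eps] is large. *)
pose m := Num.min eps 1.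
have m0 : 0 < m by rewrite lt_min eps0 ltr01.
pose d := kappa * m.
have d0 : 0 < d by rewrite mulr_gt0.
(* The integer part gives both [N <= 2 / d], which bounds the measure of Q_N from below, and
   [N + 1 > 2 / d], which makes the potential strictly exceed 2 there. *)
pose N := Num.truncn (2 / d).
have N_le : N%:R <= 2 / d by rewrite truncn_le// divr_ge0// ltW.
have N_gt : 2 < d * N.+1%:R by rewrite mulrC -ltr_pdivrMr// truncnS_gt.
pose f : n.-tuple R -> R := profile alpha d N.
have f0 x : 0 <= f x by apply: profile_ge0; exact: ltW.
pose E1 := [set x | (1 < dyadic_riesz alpha f x)%E].
pose E2 := [set x | (2%:E < dyadic_riesz alpha f x)%E /\
                    (dyadic_maximal alpha f x <= eps%:E)%E].
pose QN : set (n.-tuple R) := dyadic_cube (corner_cube (- N%:Z)).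
pose Q0 : set (n.-tuple R) := dyadic_cube (corner_cube 0).
have mQN : measurable QN by exact: measurable_dyadic_cube.
have mQ0 : measurable Q0 by exact: measurable_dyadic_cube.
have mE1 : measurable E1 by exact: measurable_dyadic_riesz_gt.
have mE2 : measurable E2.
  apply: measurableI; first exact: measurable_dyadic_riesz_gt.
  exact: measurable_dyadic_maximal_le.
have riesz_QN x : QN x -> (2%:E < dyadic_riesz alpha f x)%E.
  move=> Qx; apply: lt_le_trans (dyadic_riesz_profile_ge _ _ _ _ (ltW d0) Qx).
  by rewrite lte_fin.
have QN_E1 : QN `<=` E1.
  by move=> x /riesz_QN /=; apply: lt_trans; rewrite lte_fin ltr1n.
have QN_E2 : QN `<=` E2.
  move=> x Qx; split; first exact: riesz_QN.
  apply: le_trans (dyadic_maximal_profile_le _ halpha0 halphan _ _ _ (ltW d0)) _.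
  rewrite lee_fin -/t (_ : _ * _ = m * (1 - t)); last first.
    by rewrite /d /kappa; field; rewrite gt_eqF.
  apply: (@le_trans _ _ m); last by rewrite ge_min lexx.
  by rewrite ger_pMr// gerBl ltW.
have E1_Q0 : E1 `<=` Q0.
  move=> x /= E1x; apply: contrapT => nx; move: E1x; apply/negP; rewrite -leNgt.
  apply: le_trans (dyadic_riesz_profile_le _ halpha0 halphan _ _ _ (ltW d0) nx) _.
  rewrite lee_fin -/t (_ : d / _ = m / 2); last first.
    by rewrite /d /kappa; field; rewrite gt_eqF.
  by rewrite ler_pdivrMr// mul1r (@le_trans _ _ 1) ?ler1n// ge_min lexx orbT.
have lebQ0 : leb n Q0 = 1%E by rewrite leb_dyadic_cube /side expr0z expr1n.
have lebE1 : (leb n E1 <= 1)%E by rewrite -lebQ0 le_measure ?inE.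
exists f; split => //.
- exact: measurable_profile.
- rewrite (le_lt_trans lebE1) ?ltry// andbT.
  have : (leb n QN <= leb n E1)%E by rewrite le_measure ?inE.
  by apply: lt_le_trans; rewrite leb_dyadic_cube lte_fin exprn_gt0// side_gt0.
(* Since [E1] has measure at most 1 and [E2] contains [QN], it remains to bound the measure of [QN]
   from below. *)
apply: (@le_trans _ _ (expR (- c2) * expR (- c2 / eps))%:E).
  by rewrite -[leRHS]mule1 lee_wpmul2l// lee_fin mulr_ge0// expR_ge0.
have : (leb n QN <= leb n E2)%E by rewrite le_measure ?inE.
apply: le_trans; rewrite leb_dyadic_cube lee_fin /side /= -exprnN -expRD.
have -> : (2 ^- N) ^+ n = expR (- (N%:R * n%:R * ln 2)) :> R.
  by rewrite exprVn expRN -exprM -natrM expRM_natl lnK// posrE.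
rewrite ler_expR mulNr -opprD lerN2.
have -> : c2 + c2 / eps = 2 / kappa * (1 + eps^-1) * n%:R * ln 2.
  by rewrite /c2; ring.
rewrite ler_pM2r// ler_pM2r ?ltr0n//; apply: le_trans N_le _.
rewrite /d invfM mulrA ler_wpM2l//; first by rewrite divr_ge0// ltW.
(* In either case [m^-1 <= 1 + eps^-1]. *)
rewrite /m minEle; case: ifP => _; first by rewrite lerDr ler01.
by rewrite invr1 lerDl invr_ge0 ltW.
Qed.
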